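(* Let $m$ be a positive integer and let $\alpha\in\mathbb{F}_{2^m}$ be such that the polynomial $x^{3}+x+\alpha$ has no root in $\mathbb{F}_{2^m}$. Let $F:\mathbb{F}_{2^m}\times\mathbb{F}_{2^m}\to\mathbb{F}_{2^m}\times\mathbb{F}_{2^m}$ be given by $$F(x,y)=\left(x^{3}+xy+xy^2+\alpha y^{3},\; x^{5}+xy+\alpha x^2y^2+\alpha x^{4}y+(1+\alpha)^2 xy^{4}+\alpha y^{5}\right).$$ Then $F$ is APN.
   Context: $\mathbb{F}_{2^m}$ denotes the finite field with $2^m$ elements. A function $F:V\to V$, where $V=\mathbb{F}_{2^m}\times\mathbb{F}_{2^m}$ (identified with $\mathbb{F}_{2^{2m}}$ as an additive group), is called almost perfect nonlinear (APN) if $\max_{a\in V\setminus\{0\},\,b\in V}|\{z\in V : F(z+a)+F(z)=b\}|=2$. *)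

(* Defs.v *)
From HB Require Import structures.
From mathcomp Require Import all_boot all_order all_algebra.
Set Implicit Arguments.
Unset Strict Implicit.
Unset Printing Implicit Defensive.
Import GRing.Theory.
Local Open Scope ring_scope.

(* Makes K * K, with componentwise addition, a canonical finZmodType. *)
HB.saturate prod.

(* The derivative is taken with "+" since V is meant to be an elementary
   abelian 2-group. *)
Definition differential_count (V : finZmodType) (F : V -> V) (a b : V) : nat :=
  #|[set z : V | F (z + a) + F z == b]|.

Definition APN (V : finZmodType) (F : V -> V) : Prop :=
  \max_(a : V | a != 0) \max_(b : V) differential_count F a b = 2%N.

Definition APN_bivariate (K : finFieldType) (alpha : K) (z : K * K) : K * K :=
  let: (x, y) := z in
  (x ^+ 3 + x * y + x * y ^+ 2 + alpha * y ^+ 3,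
   x ^+ 5 + x * y + alpha * x ^+ 2 * y ^+ 2 + alpha * x ^+ 4 * y
   + (1 + alpha) ^+ 2 * x * y ^+ 4 + alpha * y ^+ 5).

(* Main.v *)
Require Import Defs.
From HB Require Import structures.
From mathcomp Require Import all_boot all_order all_algebra.
From mathcomp Require Import finfield ring.
Set Implicit Arguments.
Unset Strict Implicit.
Unset Printing Implicit Defensive.
Import GRing.Theory.
Local Open Scope ring_scope.

(** F is quadratic, so F is APN as soon as, for (a, b) != 0, the polar form
    (D1, D2) of F at (a, b) vanishes only at 0 and (a, b).  Let theta be a root
    of X^3 + X + alpha in a cubic extension of K, and put N = Norm(a + b theta),
    B = a^2 + alpha a b + b^2 and w = x b + y a.  Eliminating gives
      alpha (N D2 + B D1^2 + B N D1)
        = w Norm(alpha w + (a + alpha b^2) theta + (a^2 + b + b^2) theta^2).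
    As 1, theta, theta^2 are independent over K, the norm is nonzero when w is,
    so D1 = D2 = 0 forces w = 0, that is (x, y) = s (a, b); then
    D1 = (s^2 + s) N yields s = 0 or s = 1. *)

Definition polar1 (R : comNzRingType) (alpha a b x y : R) : R :=
  a * x ^+ 2 + a ^+ 2 * x + b * x + a * y + b ^+ 2 * x + a * y ^+ 2
  + alpha * (b * y ^+ 2 + b ^+ 2 * y).

Definition polar2 (R : comNzRingType) (alpha a b x y : R) : R :=
  a * x ^+ 4 + a ^+ 4 * x + b * x + a * y
  + alpha * (b ^+ 2 * x ^+ 2 + a ^+ 2 * y ^+ 2)
  + alpha * (b * x ^+ 4 + a ^+ 4 * y)
  + (1 + alpha) ^+ 2 * (b ^+ 4 * x + a * y ^+ 4)
  + alpha * (b * y ^+ 4 + b ^+ 4 * y).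

(* In characteristic 2, the norm of c + b theta + a theta^2. *)
Definition cubic_norm (R : comNzRingType) (alpha c b a : R) : R :=
  c ^+ 3 + alpha * b ^+ 3 + alpha ^+ 2 * a ^+ 3 + c * b ^+ 2 + c * a ^+ 2
  + alpha * a * b * c + alpha * a ^+ 2 * b.

Lemma addrr_pchar2 (R : comNzRingType) (two0 : 2%:R = 0 :> R) (x : R) :
  x + x = 0.
Proof. by rewrite -mulr2n -mulr_natl two0 mul0r. Qed.

Lemma addr_eq0_pchar2 (R : comNzRingType) (two0 : 2%:R = 0 :> R) (x y : R) :
  x + y = 0 -> x = y.
Proof.
by move=> xy0; rewrite -[RHS]add0r -xy0 -addrA (addrr_pchar2 two0) addr0.
Qed.

Lemma natr_mul2n_pchar2 (R : comNzRingType) (two0 : 2%:R = 0 :> R) n :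
  (2 * n)%:R = 0 :> R.
Proof. by rewrite natrM two0 mul0r. Qed.

Lemma natr_mul2nS_pchar2 (R : comNzRingType) (two0 : 2%:R = 0 :> R) n :
  (2 * n).+1%:R = 1 :> R.
Proof. by rewrite -natr1 natr_mul2n_pchar2 // add0r. Qed.

(* [ring: e] rewrites with e only those coefficients that are equal to its left
   side, hence one equation per numeral. *)
Ltac ring_pchar2 two0 :=
  ring: two0
    (natr_mul2nS_pchar2 two0 1 : 3%:R = 1) (natr_mul2n_pchar2 two0 2 : 4%:R = 0)
    (natr_mul2nS_pchar2 two0 2 : 5%:R = 1) (natr_mul2n_pchar2 two0 3 : 6%:R = 0)
    (natr_mul2n_pchar2 two0 4 : 8%:R = 0) (natr_mul2n_pchar2 two0 5 : 10%:R = 0)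
    (natr_mul2n_pchar2 two0 6 : 12%:R = 0).

Lemma polar_elimination (R : comNzRingType) (two0 : 2%:R = 0 :> R)
    (alpha a b x y : R) :
  let N := cubic_norm alpha a b 0 in
  let B := a ^+ 2 + alpha * a * b + b ^+ 2 in
  let w := x * b + y * a in
  alpha * (N * polar2 alpha a b x y + B * polar1 alpha a b x y ^+ 2
           + B * N * polar1 alpha a b x y)
  = w * cubic_norm alpha (alpha * w) (a + alpha * b ^+ 2)
          (a ^+ 2 + b + b ^+ 2).
Proof. by rewrite /= /polar1 /polar2 /cubic_norm; ring_pchar2 two0. Qed.

(** In characteristic 2 the norm is the resultant of a X^2 + b X + c and X^3 + X + alpha. The
    argument stays inside K: a zero norm with (c, b, a) nonzero yields a root of the cubic. *)
Lemma cubic_norm_eq0 (K : fieldType) (two0 : 2%:R = 0 :> K) (alpha : K)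
    (no_root : forall x : K, x ^+ 3 + x + alpha != 0) (c b a : K) :
  cubic_norm alpha c b a = 0 -> [/\ c = 0, b = 0 & a = 0].
Proof.
move=> N0; have noroot x : x ^+ 3 + x + alpha = 0 -> False.
  by move/eqP; rewrite (negPf (no_root x)).
have [a0|an0] := eqVneq a 0.
  move: N0; rewrite a0 /cubic_norm => N0.
  have [b0|bn0] := eqVneq b 0.
    have /eqP : c ^+ 3 = 0 by rewrite -N0 b0; ring.
    by rewrite expf_eq0 => /eqP.
  (* The norm is now b^3 times the value of the cubic at c / b. *)
  by case: (noroot (c / b)); rewrite -[RHS](mul0r (b ^- 3)) -N0; field.
(* u X + v is the remainder of a^2 (X^3 + X + alpha) by a X^2 + b X + c. *)
pose u := a ^+ 2 + a * c + b ^+ 2; pose v := a ^+ 2 * alpha + b * c.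
have divE x : a ^+ 2 * (x ^+ 3 + x + alpha)
    = (a * x ^+ 2 + b * x + c) * (a * x + b) + (u * x + v).
  by rewrite /u /v; ring_pchar2 two0.
(* Resultant of the quadratic and the remainder, equal to a^2 times the norm. *)
have resE : a * v ^+ 2 + b * u * v + c * u ^+ 2 = 0.
  rewrite -[RHS](mulr0 (a ^+ 2)) -N0 /u /v /cubic_norm; ring_pchar2 two0.
have noroot2 x : (a * x ^+ 2 + b * x + c) * (a * x + b) + (u * x + v) = 0
    -> False.
  rewrite -divE => /eqP; rewrite mulf_eq0 expf_eq0 (negPf an0) /=.
  by move/eqP/noroot.
(* If u = 0, the remainder vanishes and the root b / a of the quotient is a root of the cubic.
   Otherwise v / u is a common root of remainder and quadratic. *)
have [u0|un0] := eqVneq u 0.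
  have v0 : v = 0.
    move: resE; rewrite u0 => /eqP.
    rewrite mulr0 mul0r expr0n /= mulr0 !addr0 mulf_eq0 (negPf an0) /=.
    by rewrite expf_eq0 => /eqP.
  case: (noroot2 (b / a)); rewrite u0 v0 mul0r !addr0.
  by rewrite mulrC [a * _]mulrC divfK // (addrr_pchar2 two0) mul0r.
case: (noroot2 (v / u)).
have -> : a * (v / u) ^+ 2 + b * (v / u) + c = 0.
  by rewrite -[RHS](mul0r (u ^- 2)) -resE; field.
by rewrite mul0r add0r mulrC divfK // (addrr_pchar2 two0).
Qed.

Lemma polar_kernel (K : fieldType) (two0 : 2%:R = 0 :> K) (alpha : K)
    (no_root : forall x : K, x ^+ 3 + x + alpha != 0) (a b x y : K) :
  (a, b) != 0 -> polar1 alpha a b x y = 0 -> polar2 alpha a b x y = 0 ->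
  (x, y) = 0 \/ (x, y) = (a, b).
Proof.
move=> ab0 D1 D2.
have Nn0 : cubic_norm alpha a b 0 != 0.
  by apply: contra_neq ab0 => /(cubic_norm_eq0 two0 no_root)[-> ->].
(* 0 is not a root of the cubic. Hence alpha w = 0, the constant coordinate of the norm in the
   elimination, will force w = 0. *)
have alpha0 : alpha != 0 by have := no_root 0; rewrite expr0n /= !add0r.
have w0 : x * b + y * a = 0.
  apply/eqP; apply: contraT => wn0.
  have := polar_elimination two0 alpha a b x y.
  rewrite /= D1 D2 !(mulr0, expr0n, addr0) => /esym/eqP.
  rewrite mulf_eq0 (negPf wn0) => /eqP.
  case/(cubic_norm_eq0 two0 no_root)=> /eqP.
  by rewrite mulf_eq0 (negPf alpha0) (negPf wn0).
have xbya := addr_eq0_pchar2 two0 w0.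
have [s [xE yE]] : exists s, x = s * a /\ y = s * b.
  have [a0|an0] := eqVneq a 0.
    have bn0 : b != 0.
      by apply: contra_neq ab0 => b0; rewrite a0 b0.
    exists (y / b); rewrite divfK //; split=> //.
    by apply: (mulIf bn0); rewrite xbya a0 !mulr0 mul0r.
  exists (x / a); rewrite divfK //; split=> //.
  by apply: (mulIf an0); rewrite -xbya; field.
have : (s * (s + 1)) * cubic_norm alpha a b 0 = 0.
  by rewrite -[RHS]D1 xE yE /polar1 /cubic_norm; ring_pchar2 two0.
move/eqP; rewrite mulf_eq0 (negPf Nn0) orbF mulf_eq0 => /orP[] /eqP sE.
  by left; rewrite xE yE sE !mul0r.
by right; rewrite xE yE (addr_eq0_pchar2 two0 sE) !mul1r.
Qed.

(** As F is quadratic, its derivative along (a, b) is the polar form plus a constant; summing two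
    equal values cancels the constant and, by additivity, leaves the polar form at the sum of the
    points. *)
Lemma APN_bivariate_polar (K : finFieldType) (two0 : 2%:R = 0 :> K) (alpha : K)
    (a b x y x' y' : K) :
  let F := APN_bivariate alpha in
  F ((x, y) + (a, b)) + F (x, y) = F ((x', y') + (a, b)) + F (x', y') ->
  polar1 alpha a b (x + x') (y + y') = 0
  /\ polar2 alpha a b (x + x') (y + y') = 0.
Proof.
move=> /= [E1 E2].
have add0 u v : u = v -> u + v = 0 :> K by move->; apply: addrr_pchar2.
split.
  by rewrite -[RHS](add0 _ _ E1) /polar1; ring_pchar2 two0.
by rewrite -[RHS](add0 _ _ E2) /polar2; ring_pchar2 two0.
Qed.

Theorem theorem4 (m : nat) (m_gt0 : (0 < m)%N)
    (K : finFieldType) (cardK : #|K| = (2 ^ m)%N) (alpha : K)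
    (no_root : forall x : K, ~~ root ('X^3 + 'X + alpha%:P) x) :
  APN (APN_bivariate alpha).
Proof.
have two0 : 2%:R = 0 :> K.
  exact: (pcharf0 (card_finPcharP cardK isT)).
have noroot x : x ^+ 3 + x + alpha != 0.
  by have := no_root x; rewrite /root !hornerE.
rewrite /APN; apply/eqP; rewrite eqn_leq; apply/andP; split.
  apply/bigmax_leqP=> -[a b] ab0; apply/bigmax_leqP=> c _.
  rewrite /differential_count.
  (* A fibre containing z lies in {z, z + (a, b)}, since z + z' is in the kernel of the polar form
     for every other member z'. *)
  case: (set_0Vmem [set z | APN_bivariate alpha (z + (a, b))
                            + APN_bivariate alpha z == c]) => [->|[z zP]].
    by rewrite cards0.
  apply: (@leq_trans #|[set z; z + (a, b)]|); last first.
    by rewrite cards2; case: (_ == _).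
  apply: subset_leq_card; apply/subsetP=> z' z'P; rewrite !inE in zP z'P *.
  case: z z' zP z'P => [x y] [x' y'] /eqP zE /eqP z'E.
  have [D1 D2] := APN_bivariate_polar two0 (etrans zE (esym z'E)).
  have addK u v : v = u + (u + v) :> K by ring_pchar2 two0.
  case: (polar_kernel two0 noroot ab0 D1 D2) => -[xE yE]; apply/orP.
    by left; rewrite (addK x x') (addK y y') xE yE !addr0.
  by right; rewrite (addK x x') (addK y y') xE yE.
(* The bound is attained in any nonzero direction, here (1, 0): the fibre through 0 also contains
   the direction itself. *)
have e0 : (1, 0) != 0 :> K * K by rewrite xpair_eqE oner_eq0.
pose F := APN_bivariate alpha.
apply: (bigmax_sup (1, 0)) => //.
apply: (bigmax_sup (F (1, 0) + F 0)) => //.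
have <- : #|[set 0; (1, 0) : K * K]| = 2%N by rewrite cards2 eq_sym e0.
apply: subset_leq_card; apply/subsetP=> z; rewrite !inE.
case/orP=> /eqP->; first by rewrite add0r.
have -> : (1, 0) + (1, 0) = 0 :> K * K.
  by congr (_, _); apply: addrr_pchar2.
by rewrite addrC.
Qed.
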